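(* For integers $m,n$, let $P(m,n)=\langle x,y,z\mid xz^{m}xz^{-m}x^{-1}z^{n}yz^{-n}y^{-1}\rangle$. If $m$ is odd and $m-n\equiv2\pmod 4$, then $P(m,n)$ is not isomorphic to the free group $F_2$ of rank $2$. Moreover, in that case, $P(m,n)$ is not isomorphic to $P(m',n')$ for any integers $m',n'$ such that $m'$ is even or $m'-n'\not\equiv2\pmod 4$.
   Context: The groups $P(m,n)$ are Baumslag's one-relator parafree groups, indexed by pairs of integers $m$ and $n$. *)

(* Defs.v *)
From HB Require Import structures.
From mathcomp Require Import all_boot all_algebra.
From mathcomp Require Import boolp classical_sets.

Set Implicit Arguments.
Unset Strict Implicit.
Unset Printing Implicit Defensive.

Local Open Scope group_scope.

(* A letter (x, false) stands for x, and (x, true) for x^-1; the elements of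
   the free group on X are the freely reduced words. *)
Section FreeGroup.
Variable X : choiceType.

Local Notation letter := (X * bool)%type.

Definition flip (a : letter) : letter := (a.1, ~~ a.2).

Definition reduced (w : seq letter) : bool :=
  sorted (fun a b => b != flip a) w.

Definition push (a : letter) (w : seq letter) : seq letter :=
  if w is b :: w' then if b == flip a then w' else a :: w else [:: a].

(* The reduced form of u ++ v, when v is reduced. *)
Definition push_word (u v : seq letter) : seq letter := foldr push v u.

Lemma flipK : involutive flip.
Proof. by case=> x b; rewrite /flip /= negbK. Qed.

Lemma push_reduced a w : reduced w -> reduced (push a w).
Proof.
case: w => [|b w] //= Hw; case: eqP => [_|/eqP ab]; first exact: path_sorted Hw.
by rewrite /reduced /= ab.
Qed.

Lemma push_word_reduced u v : reduced v -> reduced (push_word u v).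
Proof. by move=> rv; elim: u => //= a u; apply: push_reduced. Qed.

Lemma pushK a w : reduced w -> push (flip a) (push a w) = w.
Proof.
case: w => [|b w] /=; first by rewrite flipK eqxx.
case: eqP => [->|ab] /=; last by rewrite flipK eqxx.
case: w => [|c w] //= /andP[ca _].
by rewrite (negPf ca).
Qed.

Lemma push_word_push a u v :
  reduced v -> push_word (push a u) v = push a (push_word u v).
Proof.
move=> rv; case: u => [|b u] //=; case: eqP => [->|] //=.
by have := pushK (flip a) (push_word_reduced u rv); rewrite flipK.
Qed.

Lemma push_wordA u v w :
  reduced w -> push_word u (push_word v w) = push_word (push_word u v) w.
Proof. by move=> rw; elim: u => //= a u ->; rewrite push_word_push. Qed.

Lemma push_word0 u : reduced u -> push_word u [::] = u.
Proof.
elim: u => //= a u IHu ru; rewrite IHu; last exact: path_sorted ru.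
by case: u ru {IHu} => //= b u /andP[/negPf->].
Qed.

Definition inv_word (u : seq letter) : seq letter := rev (map flip u).

Lemma inv_word_reduced u : reduced u -> reduced (inv_word u).
Proof.
rewrite /reduced /inv_word rev_sorted sorted_map; apply: sub_sorted => a b.
apply: contra => /eqP /= ->; by rewrite flipK.
Qed.

Lemma push_inv_word u v : reduced v -> push_word (inv_word u) (push_word u v) = v.
Proof.
elim: u v => //= a u IHu v rv.
rewrite /inv_word /= rev_cons -cats1 /push_word foldr_cat /=.
by rewrite pushK; [exact: IHu | exact: push_word_reduced].
Qed.

Definition free_group : Type := {w : seq letter | reduced w}.
HB.instance Definition _ := Choice.on free_group.

Definition free_mul (u v : free_group) : free_group :=
  Sub (push_word (val u) (val v)) (push_word_reduced (val u) (valP v)).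
Definition free_one : free_group := Sub [::] isT.
Definition free_inv (u : free_group) : free_group :=
  Sub (inv_word (val u)) (inv_word_reduced (valP u)).

Lemma free_mulA : associative free_mul.
Proof. by move=> u v w; apply: val_inj; rewrite /= push_wordA ?(valP w). Qed.
Lemma free_mul1 : left_id free_one free_mul.
Proof. by move=> u; apply: val_inj. Qed.
Lemma free_mulr1 : right_id free_one free_mul.
Proof. by move=> u; apply: val_inj; rewrite /= push_word0 ?(valP u). Qed.
Lemma free_mulV : left_inverse free_one free_inv free_mul.
Proof.
move=> u; apply: val_inj => /=.
by rewrite -{2}[val u]push_word0 ?(valP u) // push_inv_word.
Qed.
Lemma free_mulrV : right_inverse free_one free_inv free_mul.
Proof.
have invK : involutive free_inv.
  move=> u; apply: val_inj => /=.
  by rewrite /inv_word map_rev revK -map_comp (eq_map flipK) map_id.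
by move=> u; rewrite -{1}[u]invK free_mulV.
Qed.

HB.instance Definition _ := isGroup.Build free_group
  free_mulA free_mul1 free_mulr1 free_mulV free_mulrV.

Definition gen (x : X) : free_group := Sub [:: (x, false)] isT.

End FreeGroup.

Section Quotient.
Variables (G : groupType) (R : set G).

Definition normal_subgroup (N : set G) : Prop :=
  [/\ N 1, (forall u v, N u -> N v -> N (u * v)),
      (forall u, N u -> N u^-1) & (forall u g, N u -> N (u ^ g))].

Definition normal_closure : set G :=
  [set u | forall N : set G, normal_subgroup N -> (R `<=` N)%classic -> N u].

Lemma normal_closure_normal : normal_subgroup normal_closure.
Proof.
split.
- by move=> N [].
- by move=> u v Hu Hv N nN RN; have [_ NM _ _] := nN; apply: NM; [apply: Hu|apply: Hv].
- by move=> u Hu N nN RN; have [_ _ NV _] := nN; apply: NV; apply: Hu.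
- by move=> u g Hu N nN RN; have [_ _ _ NJ] := nN; apply: NJ; apply: Hu.
Qed.

Definition coset_rel (u v : G) : bool := `[< normal_closure (u^-1 * v) >].

Lemma coset_rel_equiv : equiv_class_of coset_rel.
Proof.
have [N1 NM NV _] := normal_closure_normal; split.
- by move=> u; apply/asboolP; rewrite mulVg.
- by move=> u v; apply/asboolP/asboolP => /NV; rewrite invgM invgK.
- move=> v u w /asboolP uv /asboolP vw; apply/asboolP.
  by have := NM _ _ uv vw; rewrite -mulgA mulVKg.
Qed.

Definition coset_equiv := EquivRelPack coset_rel_equiv.

(* The quotient of G by the normal closure of R. *)
Definition quotient_group : Type := {eq_quot coset_equiv}%qT.
HB.instance Definition _ := Choice.on quotient_group.

Definition proj (u : G) : quotient_group := (\pi_({eq_quot coset_equiv}) u)%qT.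

Definition quotient_mul (a b : quotient_group) : quotient_group :=
  proj (repr a * repr b).
Definition quotient_one : quotient_group := proj 1.
Definition quotient_inv (a : quotient_group) : quotient_group :=
  proj (repr a)^-1.

Lemma proj_repr a : proj (repr a) = a.
Proof. exact: reprK. Qed.

Lemma projP u v : reflect (proj u = proj v) (coset_rel u v).
Proof. exact: (iffP (eqmodP coset_equiv u v)). Qed.

Lemma repr_proj u : normal_closure (u^-1 * repr (proj u)).
Proof. by apply/asboolP; apply/projP; rewrite proj_repr. Qed.

Lemma projM u v : proj (u * v) = quotient_mul (proj u) (proj v).
Proof.
have [_ NM _ NJ] := normal_closure_normal.
apply/projP/asboolP; have := NM _ _ (NJ _ v (repr_proj u)) (repr_proj v).
by rewrite /conjg invgM !mulgA mulgK.
Qed.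

Lemma projV u : proj u^-1 = quotient_inv (proj u).
Proof.
have [_ _ NV NJ] := normal_closure_normal.
apply/projP/asboolP; have := NV _ (NJ _ u^-1 (repr_proj u)).
by rewrite /conjg !invgM !invgK !mulgA mulgK.
Qed.

Lemma quotient_mulA : associative quotient_mul.
Proof.
move=> a b c; rewrite -[a]proj_repr -[b]proj_repr -[c]proj_repr.
by rewrite -!projM mulgA.
Qed.
Lemma quotient_mul1 : left_id quotient_one quotient_mul.
Proof. by move=> a; rewrite -[a]proj_repr -projM mul1g. Qed.
Lemma quotient_mulr1 : right_id quotient_one quotient_mul.
Proof. by move=> a; rewrite -[a]proj_repr -projM mulg1. Qed.
Lemma quotient_mulV : left_inverse quotient_one quotient_inv quotient_mul.
Proof. by move=> a; rewrite -[a]proj_repr -projV -projM mulVg. Qed.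
Lemma quotient_mulrV : right_inverse quotient_one quotient_inv quotient_mul.
Proof. by move=> a; rewrite -[a]proj_repr -projV -projM mulgV. Qed.

HB.instance Definition _ := isGroup.Build quotient_group
  quotient_mulA quotient_mul1 quotient_mulr1 quotient_mulV quotient_mulrV.

End Quotient.

Definition isomorphic (G H : groupType) : Prop :=
  exists f : {multiplicative G -> H}, bijective f.

Definition expgz (G : groupType) (g : G) (k : int) : G :=
  match k with Posz n => g ^+ n | Negz n => g ^- n.+1 end.

Definition F2 : groupType := free_group 'I_2.

Definition baumslag_relator (m n : int) : free_group 'I_3 :=
  let x := gen (inord 0 : 'I_3) in
  let y := gen (inord 1 : 'I_3) in
  let z := gen (inord 2 : 'I_3) in
  x * expgz z m * x * expgz z (- m)%R * x^-1
    * expgz z n * y * expgz z (- n)%R * y^-1.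

Definition baumslagP (m n : int) : groupType :=
  quotient_group [set baumslag_relator m n]%classic.

(* Main.v *)
Require Import Defs.
From HB Require Import structures.
From mathcomp Require Import all_boot all_algebra.
From mathcomp Require Import fingroup perm generic_quotient.
From mathcomp Require Import zify.
From mathcomp Require Import boolp classical_sets.

Set Implicit Arguments.
Unset Strict Implicit.
Unset Printing Implicit Defensive.

(** The groups are told apart by the number of their homomorphisms to the
    symmetric group S_4.  For the free group of rank 2 this number is
    24^2 = 576; for P(m,n) it is 768 if m is odd and m - n = 2 mod 4, and it is
    576 otherwise ([card_baumslag_solutions_S4]).

    The reason is the decomposition of S_4 as the semidirect product of the
    Klein group V, a plane over the field with two elements, by S_3 = GL(V).
    In S_3 the relation determines x from y and z, so that P(m,n) has 36
    homomorphisms r to S_3, like the free group.  The lifts of r to S_4 are the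
    1-cocycles of P(m,n) in V: the solutions, in V^3, of the linear equation
    with values in V whose coefficients are the images under r of the three Fox
    derivatives of the relator.  If this system has rank 2, then r has
    16 lifts, as for the free group.  The derivative in y is a conjugate of
    z^n - 1 and the one in x is 1 + x z^m - x z^m x z^-m x^-1; a common left
    kernel forces m and n to be odd, r(z) to be a transposition and r(x) to
    have order 3.  There are twelve such r, one for each z and each y outside
    the centralizer of z.  The kernel is then a line, and on it
    the derivative in z vanishes if and only if (m - 1)/2 + (n - 1)/2 is odd,
    which means m - n = 2 mod 4.  In that case each of the twelve r has
    32 lifts instead of 16, hence the 192 additional homomorphisms.

    The count itself is made by evaluation.  The universal properties of free
    groups and of quotients identify the homomorphisms from P(m,n) with the
    triples of permutations that satisfy the relation
    ([more_homs_than_baumslag]).  These are sorted by their last entry z, since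
    the condition on the other two entries involves only z^m and z^n.  Every
    element of S_4 satisfies z^4 = 1 or z^3 = 1; the elements with z^4 = 1
    contribute a number that depends on m and n modulo 4
    ([sum_fiber_exp4]), and the 3-cycles always contribute the same number
    ([sum_fiber_exp3]). *)

Local Open Scope group_scope.

(** * Homomorphisms out of free groups and quotients *)

Section Multiplicative.
Variables (G H : groupType) (f : {multiplicative G -> H}).

Lemma multiplicative1 : f 1 = 1.
Proof. by apply: (mulgI (f 1)); rewrite -gmulfM !mulg1. Qed.

Lemma multiplicativeV u : f u^-1 = (f u)^-1.
Proof.
by apply: (mulgI (f u)); rewrite -gmulfM !mulgV multiplicative1.
Qed.

Lemma multiplicativeX u k : f (u ^+ k) = f u ^+ k.
Proof.
by elim: k => [|k IHk]; rewrite ?multiplicative1 // !expgS gmulfM IHk.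
Qed.

Lemma multiplicative_expgz u k : f (expgz u k) = expgz (f u) k.
Proof. by case: k => k /=; rewrite ?multiplicativeV multiplicativeX. Qed.

End Multiplicative.

Section FreeLift.
Variables (X : choiceType) (H : groupType).

Definition letter_value (f : X -> H) (a : X * bool) : H :=
  if a.2 then (f a.1)^-1 else f a.1.

Definition word_value (f : X -> H) (w : seq (X * bool)) : H :=
  foldr (fun a h => letter_value f a * h) 1 w.

Definition free_lift (f : X -> H) (u : free_group X) : H :=
  word_value f (val u).

Lemma letter_value_flip f a : letter_value f (flip a) = (letter_value f a)^-1.
Proof. by case: a => x [] //=; rewrite /letter_value /= invgK. Qed.

Lemma word_value_push f a w :
  word_value f (push a w) = letter_value f a * word_value f w.
Proof.
case: w => [|b w] //=; case: eqP => [->|] //=.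
by rewrite letter_value_flip mulVKg.
Qed.

Lemma free_liftM f : {morph free_lift f : u v / u * v}.
Proof.
move=> [u ru] v; rewrite /free_lift /= => {ru}.
by elim: u => [|a u IHu] /=; rewrite ?mul1g // word_value_push IHu mulgA.
Qed.

HB.instance Definition _ f :=
  isMultiplicative.Build (free_group X) H (free_lift f) (free_liftM f).

Lemma free_lift_gen f x : free_lift f (gen x) = f x.
Proof. by rewrite /free_lift /= mulg1. Qed.

End FreeLift.

(** A reduced word is the product of its letters: multiplying a reduced word by
    its next letter causes no cancellation. *)
Lemma free_lift_id (X : choiceType) (u : free_group X) :
  free_lift (@gen X) u = u.
Proof.
case: u => w rw; elim: w rw => [|a w IHw] rw; first exact: val_inj.
have rw' : reduced w by exact: path_sorted rw.
have {}IHw := IHw rw'; rewrite /free_lift /= in IHw *; rewrite IHw.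
apply: val_inj => /=.
have -> : val (letter_value (@gen X) a) = [:: a] by case: a {rw} => x [].
by case: w rw {rw' IHw} => //= b w /andP[/negPf->].
Qed.

Lemma free_hom_ext (X : choiceType) (H : groupType)
    (f g : {multiplicative free_group X -> H}) :
  (forall x, f (gen x) = g (gen x)) -> f =1 g.
Proof.
move=> fg u; rewrite -[u]free_lift_id /free_lift.
elim: (val u) => [|a w IHw] /=; first by rewrite !multiplicative1.
rewrite !gmulfM IHw; congr (_ * _); case: a => x [] /=; last exact: fg.
by rewrite /letter_value /= !multiplicativeV fg.
Qed.

HB.instance Definition _ (G : groupType) (R : set G) :=
  isMultiplicative.Build G (quotient_group R) (@proj G R) (@projM G R).

Section QuotientLift.
Variables (G H : groupType) (R : set G) (f : {multiplicative G -> H}).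
Hypothesis fR : forall r, R r -> f r = 1.

(** The kernel of [f] is one of the normal subgroups over which the normal
    closure is the intersection. *)
Lemma normal_closure_kernel u : normal_closure R u -> f u = 1.
Proof.
move=> /(_ [set v | f v = 1]%classic); apply; last exact: fR.
split=> [|v w /= fv fw|v /= fv|v w /= fv].
- exact: multiplicative1.
- by rewrite gmulfM fv fw mulg1.
- by rewrite multiplicativeV fv invg1.
- by rewrite /conjg !gmulfM fv mul1g multiplicativeV mulVg.
Qed.

Definition quotient_lift (a : quotient_group R) : H := f (repr a).

Lemma quotient_lift_proj u : quotient_lift (proj R u) = f u.
Proof.
have := normal_closure_kernel (@repr_proj _ R u).
by rewrite gmulfM multiplicativeV => /(canRL (mulKVg _)); rewrite mulg1.
Qed.

Lemma quotient_liftM : {morph quotient_lift : a b / a * b}.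
Proof.
move=> a b; rewrite -[a]proj_repr -[b]proj_repr -gmulfM.
by rewrite !quotient_lift_proj gmulfM.
Qed.

HB.instance Definition _ :=
  isMultiplicative.Build (quotient_group R) H quotient_lift quotient_liftM.

(** The same function, packaged with its morphism structure so that it can be
    used as a term of the type of morphisms. *)
Definition quotient_hom : {multiplicative quotient_group R -> H} :=
  quotient_lift.

End QuotientLift.

(** * Comparing numbers of homomorphisms *)

(** The type of homomorphisms has no finiteness structure, so that its size is
    bounded below by a finite family of pairwise distinct homomorphisms. *)
Definition more_homs_than (N : nat) (G H : groupType) : Prop :=
  exists (T : finType) (F : T -> {multiplicative G -> H}),
    (N < #|T|)%N /\ forall s t, F s =1 F t -> s = t.

Lemma more_homs_than_isomorphic N (G G' H : groupType) :
  isomorphic G G' -> more_homs_than N G H -> more_homs_than N G' H.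
Proof.
move=> [f [g fK gK]] [T [F [NT Finj]]].
have gM : {morph g : u v / u * v}.
  by move=> u v; apply: (can_inj fK); rewrite gmulfM !gK.
pose gm := isMultiplicative.Build G' G g gM.
pose gh : {multiplicative G' -> G} := HB.pack g gm.
exists T, (fun t => F t \o gh : {multiplicative G' -> H}); split=> // s t Fst.
by apply: Finj => u; have /= := Fst (f u); rewrite fK.
Qed.

(** The map [ev] stands for the evaluation on a generating family: it separates
    homomorphisms, and its values satisfy the relations recorded in [A]. *)
Lemma more_homs_than_bound N (G H : groupType) (U : finType)
    (A : {set U}) (ev : {multiplicative G -> H} -> U) :
    (forall f, ev f \in A) -> (forall f g, ev f = ev g -> f =1 g) ->
  (#|A| <= N)%N -> ~ more_homs_than N G H.
Proof.
move=> evA evI AN [T [F [NT Finj]]].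
have inj : injective (fun t => ev (F t)) by move=> s t /evI /Finj.
have sub : [set ev (F t) | t : T] \subset A.
  by apply/fintype.subsetP => _ /imsetP[t _ ->].
have := leq_trans (subset_leq_card sub) AN.
by rewrite card_imset // leqNgt NT.
Qed.

Lemma free2_homs (H : finGroupType) : ~ more_homs_than (#|H| ^ 2) F2 H.
Proof.
pose a : F2 := gen ord0; pose b : F2 := gen ord_max.
apply: (@more_homs_than_bound _ _ _ _ [set: H * H] (fun f => (f a, f b))).
- by move=> f; rewrite finset.in_setT.
- move=> f g [fga fgb]; apply: free_hom_ext => i.
  case: (unliftP ord0 i) => [j|] -> //; rewrite (ord1 j).
  by have -> : lift ord0 ord0 = ord_max :> 'I_2 by apply: val_inj.
- by rewrite cardsT card_prod.
Qed.

(** * Homomorphisms from the Baumslag groups *)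

Definition relator_value (H : groupType) (m n : int) (x y z : H) : H :=
  x * expgz z m * x * expgz z (- m)%R * x^-1
    * expgz z n * y * expgz z (- n)%R * y^-1.

Lemma multiplicative_relator_value (G H : groupType)
    (f : {multiplicative G -> H}) m n x y z :
  f (relator_value m n x y z) = relator_value m n (f x) (f y) (f z).
Proof.
by rewrite /relator_value !gmulfM !multiplicativeV !multiplicative_expgz.
Qed.

Section BaumslagHoms.
Variables (H : finGroupType) (m n : int).

Definition baumslag_solutions : {set H * H * H} :=
  [set t | relator_value m n t.1.1 t.1.2 t.2 == 1].

Definition triple_value (t : H * H * H) (i : 'I_3) : H :=
  nth 1 [:: t.1.1; t.1.2; t.2] i.

Lemma triple_value_kills (t : H * H * H) : t \in baumslag_solutions ->
  forall r, [set baumslag_relator m n]%classic r ->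
    free_lift (triple_value t) r = 1.
Proof.
rewrite inE => /eqP t1 _ ->.
rewrite -[baumslag_relator m n]/(relator_value m n
  (gen (inord 0)) (gen (inord 1)) (gen (inord 2))).
rewrite multiplicative_relator_value /= !free_lift_gen.
by rewrite /triple_value !inordK.
Qed.

Definition triple_hom (t : {t | t \in baumslag_solutions}) :
  {multiplicative baumslagP m n -> H} :=
  quotient_hom (triple_value_kills (valP t)).

Definition baumslag_gen (k : nat) : baumslagP m n :=
  proj [set baumslag_relator m n]%classic (gen (inord k)).

Definition hom_triple (f : {multiplicative baumslagP m n -> H}) : H * H * H :=
  (f (baumslag_gen 0), f (baumslag_gen 1), f (baumslag_gen 2)).

Lemma triple_homK t : hom_triple (triple_hom t) = val t.
Proof.
have genE k : triple_hom t (baumslag_gen k) = triple_value (val t) (inord k).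
  exact: etrans (quotient_lift_proj (triple_value_kills (valP t)) _)
                (free_lift_gen _ _).
rewrite /hom_triple !genE /triple_value !inordK //=.
by case: (val t) => [[]].
Qed.

Lemma hom_triple_ext f g : hom_triple f = hom_triple g -> f =1 g.
Proof.
case=> fg0 fg1 fg2 u; rewrite -[u]proj_repr.
apply: (@free_hom_ext _ _ (f \o @proj _ _) (g \o @proj _ _)) => i /=.
by rewrite -[i]inord_val; case: i => [[|[|[|i]]]].
Qed.

Lemma baumslag_gen_relation :
  relator_value m n (baumslag_gen 0) (baumslag_gen 1) (baumslag_gen 2) = 1.
Proof.
rewrite -multiplicative_relator_value; apply/esym/projP/asboolP.
by rewrite invg1 mul1g => N _; apply.
Qed.

(** Evaluation on the generators is a bijection from the homomorphisms
    P(m,n) -> H to the solutions of the relation in H. *)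
Lemma more_homs_than_baumslag N :
  more_homs_than N (baumslagP m n) H <-> (N < #|baumslag_solutions|)%N.
Proof.
split=> [|Nsol].
  apply: contraPltn => solN.
  apply: more_homs_than_bound hom_triple_ext solN => f.
  rewrite inE /= -multiplicative_relator_value baumslag_gen_relation.
  by rewrite multiplicative1.
exists {t | t \in baumslag_solutions}, triple_hom.
split=> [|s t st]; first by rewrite card_sig.
by apply: val_inj; rewrite -!triple_homK /hom_triple !st.
Qed.

End BaumslagHoms.

(** * Sorting the solutions by the image of z *)

Lemma expgzN (H : groupType) (z : H) k : expgz z (- k)%R = (expgz z k)^-1.
Proof.
by case: k => [[|k]|k]; rewrite ?NegzE ?GRing.opprK /= ?expg0 ?invg1 ?invgK.
Qed.

Lemma expgz_mod (H : groupType) (z : H) (e : nat) k :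
  (0 < e)%N -> z ^+ e = 1 -> expgz z k = z ^+ `|(k %% e)%Z|%N.
Proof.
move=> e_gt0 ze.
have zMe q : z ^+ (q * e) = 1 by rewrite mulnC expgnA ze expg1n.
case: k => k; first by rewrite modz_nat /= {1}(divn_eq k e) expgnDr zMe mul1g.
(* The representative of the exponent -(k + 1) is e - (k mod e) - 1, which
   adds up with k + 1 to a multiple of e. *)
have -> : `|(Negz k %% e)%Z|%N = (e - (k %% e).+1)%N.
  by rewrite modNz_nat //; have := ltn_pmod k e_gt0; lia.
rewrite /=; apply: mulg1_eq; rewrite -expgnDr.
suff -> : (k.+1 + (e - (k %% e).+1) = (k %/ e).+1 * e)%N by [].
by rewrite {1}(divn_eq k e) mulSn; have := ltn_pmod k e_gt0; lia.
Qed.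

Section Counting.
Variable H : finGroupType.

(** The number of pairs (x, y) that complete a given z to a solution of the
    relation, where u = z^m and v = z^n; the relation is written as
    x u x u^-1 x^-1 = y v y^-1 v^-1, which separates x from y. *)
Definition fiber_size (u v : H) : nat :=
  #|[set p : H * H |
     p.1 * u * p.1 * u^-1 * p.1^-1 == p.2 * v * p.2^-1 * v^-1]|.

Lemma card_baumslag_solutions m n :
  #|baumslag_solutions H m n| = \sum_z fiber_size (expgz z m) (expgz z n).
Proof.
under eq_bigr => z _ do rewrite /fiber_size -sum1dep_card.
rewrite (exchange_big_dep predT) //= pair_big_dep /= -sum1dep_card.
apply: eq_bigl => -[[x y] z] /=; rewrite /relator_value !expgzN.
by rewrite -[in RHS]divg_eq1 !invgM !invgK !mulgA.
Qed.

End Counting.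

(** * Evaluation in S_4 *)

(** Permutations of 'I_4 are finite functions, on which evaluation is blocked;
    the lists of their values are used instead. *)
Definition perm_codes : seq (seq nat) := permutations (iota 0 4).
Definition code_mul (s t : seq nat) : seq nat := [seq nth 0 t i | i <- s].
Definition code_inv (s : seq nat) : seq nat := [seq index i s | i <- iota 0 4].
Definition code_exp (s : seq nat) (k : nat) : seq nat :=
  iter k (code_mul s) (iota 0 4).
Definition code_fiber_size (u v : seq nat) : nat :=
  let u' := code_inv u in let v' := code_inv v in
  let rhs := [seq code_mul y (code_mul v (code_mul (code_inv y) v'))
             | y <- perm_codes] in
  sumn [seq count_mem
    (code_mul x (code_mul u (code_mul x (code_mul u' (code_inv x))))) rhs
       | x <- perm_codes].

(** An average of 24 pairs (x, y) for each of the 16 elements z with z^4 = 1,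
    except for the residues (1, 3) and (3, 1). *)
Lemma code_fiber_size_exp4 :
  all (fun a => all (fun b =>
    sumn [seq code_fiber_size (code_exp z a) (code_exp z b)
         | z <- perm_codes & code_exp z 4 == iota 0 4]
      == if [&& odd a, odd b & a != b] then 576 else 384)
    (iota 0 4)) (iota 0 4).
Proof. by vm_compute. Qed.

(** The elements with z^4 <> 1 are the eight 3-cycles; on average each of them
    has 24 pairs (x, y), whatever the exponents are. *)
Lemma code_fiber_size_exp3 :
  all (fun z => code_exp z 3 == iota 0 4)
     [seq z <- perm_codes | code_exp z 4 != iota 0 4] &&
  all (fun a => all (fun b =>
    sumn [seq code_fiber_size (code_exp z a) (code_exp z b)
         | z <- perm_codes & code_exp z 4 != iota 0 4]
      == 192) (iota 0 3)) (iota 0 3).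
Proof. by vm_compute. Qed.

Definition code (s : 'S_4) : seq nat := [seq val (s i) | i <- enum 'I_4].

Lemma nth_code s (i : 'I_4) : nth 0 (code s) i = s i.
Proof. by rewrite (nth_map ord0) ?size_enum_ord // nth_ord_enum. Qed.

Lemma code_inj : injective code.
Proof.
by move=> s t st; apply/permP => i; apply: val_inj; rewrite /= -!nth_code st.
Qed.

Lemma code1 : code 1 = iota 0 4.
Proof.
by rewrite -val_enum_ord; apply: eq_map => i; rewrite perm1.
Qed.

Lemma codeM s t : code (s * t) = code_mul (code s) (code t).
Proof.
by rewrite /code_mul -map_comp; apply: eq_map => i /=; rewrite nth_code permM.
Qed.

Lemma codeV s : code s^-1 = code_inv (code s).
Proof.
rewrite /code_inv -val_enum_ord -map_comp; apply: eq_map => i /=.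
rewrite -{2}[i](permKV s) (index_map (f := fun j => val (s j))).
  by rewrite index_enum_ord.
exact: inj_comp val_inj perm_inj.
Qed.

Lemma codeX s k : code (s ^+ k) = code_exp (code s) k.
Proof. by elim: k => [|k IHk]; rewrite ?code1 // expgS codeM IHk. Qed.

(** Codes are distinct rearrangements of 0, 1, 2, 3, and there are as many
    permutations as rearrangements. *)
Lemma perm_eq_codes : perm_eq (map code (enum 'S_4)) perm_codes.
Proof.
have uniq_code : uniq (map code (enum 'S_4)).
  by rewrite map_inj_uniq ?enum_uniq //; exact: code_inj.
have code_perm : {subset map code (enum 'S_4) <= perm_codes}.
  move=> _ /mapP[s _ ->]; rewrite mem_permutations -val_enum_ord.
  rewrite /code map_comp perm_map //; apply: uniq_perm; rewrite ?enum_uniq //.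
    by rewrite map_inj_uniq ?enum_uniq //; exact: perm_inj.
  move=> i; rewrite mem_enum; apply/mapP.
  by exists (s^-1 i); rewrite ?mem_enum ?permKV.
apply: uniq_perm; rewrite ?permutations_uniq //.
have [|_ eq_codes] := uniq_min_size uniq_code code_perm; last exact: eq_codes.
by rewrite size_map -cardE card_Sn.
Qed.

Lemma sum_codes (P : pred (seq nat)) (F : seq nat -> nat) :
  \sum_(z | P (code z)) F (code z) = sumn [seq F c | c <- perm_codes & P c].
Proof.
rewrite sumnE big_map big_filter -(perm_big _ perm_eq_codes) big_map /=.
by rewrite big_enum_cond.
Qed.

Lemma fiber_size_code u v :
  fiber_size u v = code_fiber_size (code u) (code v).
Proof.
rewrite /fiber_size -sum1dep_card.
rewrite -(pair_big_dep xpredT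
  (fun x y => x * u * x * u^-1 * x^-1 == y * v * y^-1 * v^-1)
  (fun _ _ => 1%N)) /=.
pose rhs y := code_mul y (code_mul (code v)
  (code_mul (code_inv y) (code_inv (code v)))).
pose lhs x := code_mul x (code_mul (code u) (code_mul x
  (code_mul (code_inv (code u)) (code_inv x)))).
rewrite -[RHS]/(sumn [seq count_mem (lhs x) [seq rhs y | y <- perm_codes]
                     | x <- perm_codes]).
rewrite -[X in sumn [seq _ | _ <- X]](filter_predT perm_codes).
rewrite -(sum_codes xpredT (fun x => count_mem (lhs x) _)).
apply: eq_bigr => x _; rewrite count_map -sum1_count.
rewrite -(perm_big _ perm_eq_codes) big_map big_enum_cond /=.
apply: eq_bigl => y; rewrite eq_sym -(inj_eq code_inj).
by rewrite /lhs /rhs -!codeV -!codeM !mulgA.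
Qed.

(** * The number of homomorphisms to S_4 *)

Lemma mod4_condition (m n : int) :
  [&& odd `|(m %% 4)%Z|, odd `|(n %% 4)%Z| & `|(m %% 4)%Z| != `|(n %% 4)%Z|]%N
    = ~~ (2 %| m)%Z && (m - n == 2 %[mod 4])%Z.
Proof. lia. Qed.

Lemma absz_mod_iota (k : int) (e : nat) :
  (0 < e)%N -> `|(k %% e)%Z|%N \in iota 0 e.
Proof. by move=> e0; rewrite mem_iota; lia. Qed.

Lemma sum_fiber_exp4 m n :
  \sum_(z : 'S_4 | z ^+ 4 == 1) fiber_size (expgz z m) (expgz z n) =
    if ~~ (2 %| m)%Z && (m - n == 2 %[mod 4])%Z then 576 else 384.
Proof.
rewrite -mod4_condition.
have /allP/(_ _ (absz_mod_iota m (isT : 0 < 4)%N)) := code_fiber_size_exp4.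
move=> /allP/(_ _ (absz_mod_iota n (isT : 0 < 4)%N))/eqP <-.
rewrite -sum_codes; apply: eq_big => [z|z /eqP z4].
  by rewrite -codeX -code1 (inj_eq code_inj).
by rewrite !(expgz_mod _ _ z4) // fiber_size_code !codeX.
Qed.

Lemma sum_fiber_exp3 m n :
  \sum_(z : 'S_4 | z ^+ 4 != 1) fiber_size (expgz z m) (expgz z n) = 192.
Proof.
have /andP[/allP exp3 /allP] := code_fiber_size_exp3.
move=> /(_ _ (absz_mod_iota m (isT : 0 < 3)%N)).
move=> /allP/(_ _ (absz_mod_iota n (isT : 0 < 3)%N))/eqP <-.
have code4 (z : 'S_4) : (code_exp (code z) 4 != iota 0 4) = (z ^+ 4 != 1).
  by rewrite -codeX -code1 (inj_eq code_inj).
rewrite -sum_codes; apply: eq_big => [z|z z4]; first by rewrite code4.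
have z3 : z ^+ 3 = 1.
  apply/eqP; rewrite -(inj_eq code_inj) codeX code1; apply: exp3.
  by rewrite mem_filter code4 z4 -(perm_mem perm_eq_codes) map_f ?mem_enum.
by rewrite !(expgz_mod _ _ z3) // fiber_size_code !codeX.
Qed.

Lemma card_baumslag_solutions_S4 m n :
  #|baumslag_solutions 'S_4 m n| =
    if ~~ (2 %| m)%Z && (m - n == 2 %[mod 4])%Z then 768 else 576.
Proof.
rewrite card_baumslag_solutions (bigID (fun z => z ^+ 4 == 1)) /=.
by rewrite sum_fiber_exp4 sum_fiber_exp3; case: ifP.
Qed.

Local Close Scope group_scope.

Theorem mainTheorem7 (m n : int)
  (hm : ~~ (2 %| m)%Z) (hmn : (m - n = 2 %[mod 4])%Z) :
  ~ isomorphic (baumslagP m n) F2 /\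
  (forall m' n' : int,
     (2 %| m')%Z \/ (m' - n' <> 2 %[mod 4])%Z ->
     ~ isomorphic (baumslagP m n) (baumslagP m' n')).
Proof.
have homsP : more_homs_than 576 (baumslagP m n) 'S_4.
  apply/more_homs_than_baumslag.
  by rewrite card_baumslag_solutions_S4 hm hmn eqxx.
split=> [iso|m' n' m'n' iso]; have := more_homs_than_isomorphic iso homsP.
  by rewrite -[576]/(4`! ^ 2) -card_Sn; exact: free2_homs.
move/more_homs_than_baumslag; rewrite card_baumslag_solutions_S4.
by case: m'n' => [->|/eqP/negPf->] //; rewrite andbF.
Qed.
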